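(* Let $G=(V,A)$ be a flow graph with start vertex $s$, and let $T$ be a rooted tree whose vertex set is a subset of $V$ and which has the parent property with respect to $G$. Then $T$ has the sibling property (and hence $T$ is the dominator tree of $G$) if and only if $T$ has a preorder that is low-high on $G$.
   Context: A flow graph is a finite directed graph $G=(V,A)$ with a designated start vertex $s$ such that every vertex is reachable from $s$; throughout, there are no arcs entering $s$ and $|V|>1$. A vertex $v$ dominates $w$ if every path from $s$ to $w$ contains $v$. The dominator tree $D$ is the tree rooted at $s$ on $V$ in which $v$ is an ancestor of $w$ iff $v$ dominates $w$. For a rooted tree $T$, $t(v)$ denotes the parent of $v$; ancestors and descendants include the vertex itself. $T$ has the parent property if for every arc $(v,w)\in A$, $t(w)$ is an ancestor of $v$ in $T$. $T$ has the sibling property if for all siblings $v,w$ in $T$ (distinct vertices with the same parent), $v$ does not dominate $w$. A preorder of $T$ is a total order of its vertices such that for every vertex $v$, the descendants of $v$ are ordered consecutively with $v$ first. A preorder of $T$ is low-high on $G$ if for every $v\neq s$, either $(t(v),v)\in A$, or there are two arcs $(u,v),(w,v)\in A$ with $u<v<w$ in the order and $w$ not a descendant of $v$ in $T$. *)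

(* Defs.v *)
From mathcomp Require Import all_boot all_order.

Set Implicit Arguments.
Unset Strict Implicit.
Unset Printing Implicit Defensive.

Record flow_graph := FlowGraph {
  vertex :> finType;
  arc : rel vertex;
  start : vertex;
  start_reach : forall v : vertex, connect arc start v;
  start_no_entry : forall v : vertex, ~~ arc v start;
  vertex_gt1 : 1 < #|vertex|
}.

Definition dominates (G : flow_graph) (v w : G) : Prop :=
  forall p : seq G, path (@arc G) (start G) p -> last (start G) p = w ->
    v \in start G :: p.

(* A rooted tree whose vertex set is a subset of V. The parent is None at the
   root and outside the vertex set. As every tree vertex climbs to the root,
   which has no parent, the parent links form no cycle. *)
Record rooted_tree (V : finType) := RootedTree {
  tverts : {set V};
  troot : V;
  tparent : V -> option V;
  troot_in : troot \in tverts;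
  tparent_in : forall v p : V,
    tparent v = Some p -> v \in tverts /\ p \in tverts;
  tparent_root : tparent troot = None;
  tclimb : forall v : V, v \in tverts ->
    connect (fun x y => tparent x == Some y) v troot
}.

Definition ancestor (V : finType) (T : rooted_tree V) (u v : V) : bool :=
  (v \in tverts T) && connect (fun x y => tparent T x == Some y) v u.

Definition descendant (V : finType) (T : rooted_tree V) (w v : V) : bool :=
  ancestor T v w.

(* For an arc (v, w), this asks in particular that w have a parent in T and
   that v be a vertex of T. *)
Definition parent_property (G : flow_graph) (T : rooted_tree G) : Prop :=
  forall v w : G, arc v w ->
    exists2 p : G, tparent T w = Some p & ancestor T p v.

Definition siblings (V : finType) (T : rooted_tree V) (v w : V) : Prop :=
  v <> w /\ exists p : V, tparent T v = Some p /\ tparent T w = Some p.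

Definition sibling_property (G : flow_graph) (T : rooted_tree G) : Prop :=
  forall v w : G, siblings T v w -> ~ dominates v w.

Definition is_dominator_tree (G : flow_graph) (T : rooted_tree G) : Prop :=
  [/\ troot T = start G,
      tverts T = [set: G] &
      forall v w : G, ancestor T v w <-> dominates v w].

Definition total_order_on (V : finType) (S : {set V}) (le : rel V) : Prop :=
  (forall x y : V, le x y -> x \in S /\ y \in S) /\
  [/\ {in S, reflexive le},
      {in S &, antisymmetric le},
      {in S & &, transitive le} &
      {in S &, total le}].

Definition is_preorder (V : finType) (T : rooted_tree V) (le : rel V) : Prop :=
  total_order_on (tverts T) le /\
  forall v : V, v \in tverts T ->
    (forall w : V, descendant T w v -> le v w) /\
    (forall x y z : V, descendant T x v -> descendant T z v ->
       le x y -> le y z -> descendant T y v).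

Definition strict (V : finType) (le : rel V) (x y : V) : bool :=
  (x != y) && le x y.

Definition low_high (G : flow_graph) (T : rooted_tree G) (le : rel G) : Prop :=
  forall v : G, v <> start G ->
    (exists2 p : G, tparent T v = Some p & arc p v) \/
    (exists u w : G,
       [/\ arc u v, arc w v, strict le u v, strict le v w
         & ~~ descendant T w v]).

(* Main.v *)
(** Tree ancestors dominate by the parent property.  For a low-high preorder, an
    extremal vertex dominated by [v] outside the subtree of [v] would have a
    low or high arc coming from a more extremal such vertex, so dominators are
    ancestors and siblings do not dominate each other.  Conversely, contract the
    subtree of each child of a vertex [p]: by the sibling property every child
    is reached from [p] avoiding any other given child.  Such a graph is
    numbered greedily from below, always taking a vertex entered from [p] or
    from a numbered vertex whose removal leaves the other unnumbered vertices
    reachable from [p] among themselves.  Ordering the vertices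
    lexicographically by the numbers along their tree paths gives the preorder. *)

From mathcomp Require Import all_boot all_order.
Require Import Defs.

Set Implicit Arguments.
Unset Strict Implicit.
Unset Printing Implicit Defensive.

Import Order.TTheory.

Lemma connect_invariant (V : finType) (e : rel V) (P : V -> Prop) (x y : V) :
  P x -> (forall a b, connect e x a -> P a -> e a b -> P b) ->
  connect e x y -> P y.
Proof.
move=> Px stepP /connectP[p].
elim/last_ind: p y => [|p b IHp] y /=; first by move=> _ ->.
rewrite rcons_path last_rcons => /andP[e_p e_b] ->.
apply: stepP (e_b); last exact: IHp e_p erefl.
by apply/connectP; exists p.
Qed.

(** * Low-high numberings when no vertex is a proper dominator *)

Section LowHighNumbering.
Variables (V : finType) (h : rel V) (r : V) (K : {set V}).

(** Only the head of an arc is confined to [X], so walks may start at [r] outside [X]. *)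
Definition step_in (X : {set V}) : rel V := [rel a b | h a b && (b \in X)].
Definition reach_in (X : {set V}) (y : V) : bool := connect (step_in X) r y.

Lemma reach_in_step X a b : reach_in X a -> h a b -> b \in X -> reach_in X b.
Proof.
move=> Xa hab Xb; apply: connect_trans Xa (connect1 _).
by rewrite /step_in /= hab.
Qed.

Lemma reach_in_mem X y : reach_in X y -> y = r \/ y \in X.
Proof.
apply: (connect_invariant (P := fun y => y = r \/ y \in X)); first by left.
by move=> a b _ _ /andP[_]; right.
Qed.

Hypothesis rNK : r \notin K.
Hypothesis reachK : {in K, forall y, reach_in K y}.
Hypothesis reachKD1 : {in K &, forall v y, v != y -> reach_in (K :\ v) y}.

Definition frontier (M : {set V}) (x : V) : bool :=
  (x \in M) && (h r x || [exists u in K :\: M, h u x]).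

(** [x] is where a walk inside [Y] enters [M] for the last time before [y]. The invariant keeps [x]
    while the walk stays in [M] and resets it on re-entry. *)
Lemma reach_in_frontier (M Y : {set V}) (y : V) :
  M \subset K -> Y \subset K -> y \in M -> reach_in Y y ->
  exists x, [/\ frontier M x, x \in Y & connect (step_in (M :&: Y)) x y].
Proof.
move=> sMK sYK My Yy; move: My.
apply: (connect_invariant (P := fun y => y \in M -> exists x,
  [/\ frontier M x, x \in Y & connect (step_in (M :&: Y)) x y])) Yy.
  by move/(subsetP sMK); rewrite (negbTE rNK).
move=> a b Ya IHa /andP[hab Yb] Mb.
have [Ma | MNa] := boolP (a \in M).
  have [x [Fx Yx xa]] := IHa Ma; exists x; split=> //.
  by apply: connect_trans xa (connect1 _); rewrite /step_in /= hab inE Mb.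
exists b; split=> //; rewrite /frontier Mb /=.
case: (reach_in_mem Ya) => [<- | Ya']; first by rewrite hab.
by apply/orP; right; apply/existsP; exists a; rewrite inE MNa (subsetP sYK).
Qed.

(* The vertices of [K :\: M] are already numbered, below those of [M].  The
   next vertex is a frontier vertex [x] maximizing the part of [M] that [r]
   reaches without [x]: any vertex cut off by [x] would be reached through
   another frontier vertex [x2] cut off by [x], and removing [x2] would cut off
   strictly less. *)
Lemma low_high_numbering_above (n : nat) (M : {set V}) :
  #|M| = n -> M \subset K -> {in M, forall y, reach_in M y} ->
  exists2 f : V -> nat, {in M &, injective f} &
    {in M, forall y, h r y \/
      (exists2 u, u \in K & h u y /\ (u \notin M \/ f u < f y)) /\
      (exists2 w, w \in M & h w y /\ f y < f w)}.
Proof.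
elim: n M => [|n IHn] M cardM sMK reachM.
  move/eqP: cardM; rewrite cards_eq0 => /eqP->.
  by exists (fun=> 0) => y; rewrite inE.
have [y0 My0] : exists y, y \in M by apply/card_gt0P; rewrite cardM.
have Ky0 := subsetP sMK _ My0.
have [x0 [Fx0 _ _]] := reach_in_frontier sMK (subxx K) My0 (reachK Ky0).
pose R x := [set y in M :\ x | reach_in (M :\ x) y].
case: (arg_maxnP (fun x => #|R x|) Fx0) => x Fx maxx.
have Mx : x \in M by case/andP: Fx.
have Kx := subsetP sMK _ Mx.
have xr : x != r by apply: contraNneq rNK => <-.
have sM'K : M :\ x \subset K by apply: subset_trans sMK; apply: subsetDl.
have reachM' : {in M :\ x, forall y, reach_in (M :\ x) y}.
  move=> y M'y; apply/negPn/negP => Ny.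
  have [yx My] : y != x /\ y \in M by move: M'y; rewrite !inE => /andP[].
  have [|x2 [Fx2 x2in x2y]] :=
    reach_in_frontier (Y := K :\ x) sMK (subsetDl _ _) My.
    by apply: reachKD1 => //; [exact: (subsetP sMK) | rewrite eq_sym].
  have x2x : x2 != x by move: x2in; rewrite !inE => /andP[].
  have Mx2 : x2 \in M by case/andP: Fx2.
  (* The walk from [x2] to [y] stays in [M :\ x], so reaching [x2] there would reach [y]. *)
  have Nx2 : ~~ reach_in (M :\ x) x2.
    apply: contra Ny => Rx2; apply: connect_trans Rx2 _.
    apply: connect_sub x2y => a b; rewrite /step_in /= => /andP[hab].
    rewrite !inE => /and3P[Mb bx _].
    by apply: connect1; rewrite /step_in /= hab !inE bx.
  (* As [x] cuts off [x2], no walk from [r] inside [M :\ x] meets [x2]. *)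
  have mono z : reach_in (M :\ x) z -> reach_in (M :\ x2) z.
    move=> Rz; apply: (connect_invariant
      (P := fun z => reach_in (M :\ x2) z)) Rz => [|a b Ra Ra2].
      exact: connect0.
    rewrite /step_in /= => /andP[hab M'b].
    have Rb : reach_in (M :\ x) b := reach_in_step Ra hab M'b.
    apply: reach_in_step Ra2 hab _.
    rewrite inE in_set1; move: M'b; rewrite inE => /andP[_ ->].
    by rewrite andbT; apply: contraNneq Nx2 => <-.
  (* Before its first visit to [x], a walk from [r] inside [M] avoids [x], hence also [x2] by
     [mono]. *)
  have Rx : reach_in (M :\ x2) x.
    have : reach_in (M :\ x) x \/ reach_in (M :\ x2) x.
      apply: (connect_invariant (P := fun b =>
        reach_in (M :\ x) b \/ reach_in (M :\ x2) x)) (reachM _ Mx).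
        by left; apply: connect0.
      move=> a b _ [Ra | ]; last by right.
      move=> /andP[hab Mb]; have [bx | bx] := eqVneq b x.
        right; rewrite bx in hab; apply: reach_in_step (mono _ Ra) hab _.
        by rewrite !inE eq_sym x2x.
      by left; apply: reach_in_step Ra hab _; rewrite !inE bx.
    case=> // /reach_in_mem[xr' | ]; first by rewrite xr' eqxx in xr.
    by rewrite !inE eqxx.
  have : R x \proper R x2.
    apply/properP; split.
      apply/subsetP => z; rewrite !inE => /andP[/andP[zx ->]] Rz.
      rewrite mono // !andbT.
      by apply: contraNneq Nx2 => <-.
    exists x; first by rewrite !inE Rx Mx eq_sym x2x.
    by rewrite !inE eqxx.
  by move/proper_card; rewrite ltnNge => /negP; apply; apply: maxx.
have cardM' : #|M :\ x| = n.
  by have := cardsD1 x M; rewrite Mx cardM add1n => -[].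
have [f injf lhf] := IHn _ cardM' sM'K reachM'.
(* [x] takes the least number and all later ones shift up by one. *)
pose g z := if z == x then 0 else (f z).+1.
have M'E z : z \in M -> z != x -> z \in M :\ x by rewrite !inE => -> ->.
exists g.
  move=> y z My Mz; rewrite /g; case: eqVneq => [-> | yx].
    by case: eqVneq => [-> | zx].
  by case: eqVneq => [// | zx] [] /injf; apply; apply: M'E.
move=> y My; have [-> | yx] := eqVneq y x.
  (* Unless [r] itself has an arc to [x], the high arc is the last arc of a walk from [r] to [x],
     and the frontier condition supplies the low arc. *)
  have : x <> x \/ exists2 a, a != x & h a x /\ (a = r \/ a \in M).
    apply: (connect_invariant (P := fun b => b <> x \/
      exists2 a, a != x & h a x /\ (a = r \/ a \in M))) (reachM _ Mx).
      by left=> rx; rewrite rx eqxx in xr.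
    move=> a b Ra [/eqP ax | ]; last by right.
    move=> /andP[hab Mb]; have [bx | /eqP bx] := eqVneq b x; last by left.
    right; exists a => //; split; first by rewrite -bx.
    exact: reach_in_mem Ra.
  case=> // -[w wx [hwx [wr | Mw]]]; first by left; rewrite -wr.
  case/andP: Fx => _ /orP[ | /existsP[u /andP[]]]; first by left.
  rewrite inE => /andP[MNu Ku] hux; right; split.
    by exists u => //; split=> //; left.
  by exists w => //; split=> //; rewrite /g eqxx (negbTE wx).
case: (lhf y (M'E _ My yx)) => [ | [[u Ku [huy uP]] [w M'w [hwy fw]]]].
  by left.
right; split.
  exists u => //; split=> //; rewrite /g (negbTE yx).
  (* A low neighbour outside [M :\ x] is either [x], numbered 0, or outside [M]. *)
  have [_ | ux] := eqVneq u x; first by right.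
  case: uP => [ | fu]; last by right.
  by rewrite !inE ux /=; left.
have [wx Mw] : w != x /\ w \in M by move: M'w; rewrite !inE => /andP[].
by exists w => //; split=> //; rewrite /g (negbTE yx) (negbTE wx).
Qed.

Lemma low_high_numbering :
  exists2 f : V -> nat, {in K &, injective f} &
    {in K, forall y, h r y \/
      (exists2 u, u \in K & h u y /\ f u < f y) /\
      (exists2 w, w \in K & h w y /\ f y < f w)}.
Proof.
have [f injf lhf] := low_high_numbering_above erefl (subxx K) reachK.
exists f => // y Ky; case: (lhf y Ky) => [|[[u Ku [huy uP]] wP]]; first by left.
by right; split=> //; exists u => //; split=> //; case: uP; rewrite ?Ku.
Qed.

End LowHighNumbering.

(** * Rooted trees *)

Section RootedTree.
Variables (V : finType) (T : rooted_tree V).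
Implicit Types u v w p x : V.

Notation climb := (connect (fun x y => tparent T x == Some y)).

Lemma tree_ind (P : V -> Prop) :
  P (troot T) -> (forall v p, tparent T v = Some p -> P p -> P v) ->
  {in tverts T, forall v, P v}.
Proof.
move=> Proot Pstep v /tclimb/connectP[q].
elim: q v => [|p q IHq] v /=; first by move=> _ <-.
by case/andP=> /eqP vp pq lq; apply: Pstep vp (IHq _ pq lq).
Qed.

Lemma climb_inv v u : climb v u ->
  v = u \/ exists2 p, tparent T v = Some p & climb p u.
Proof.
case/connectP=> -[|p q] /=; first by left.
case/andP=> /eqP vp pq lq; right; exists p => //.
by apply/connectP; exists q.
Qed.

Lemma climb_parent v p : tparent T v = Some p -> climb v p.
Proof. by move=> vp; apply: connect1; rewrite vp. Qed.

Lemma climb_root v : climb (troot T) v -> v = troot T.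
Proof. by case/climb_inv=> // -[p]; rewrite tparent_root. Qed.

Lemma tparent_irrefl v : tparent T v <> Some v.
Proof.
move=> vv; have [Tv _] := tparent_in vv; move: v Tv vv.
apply: tree_ind => [|v p vp IHp]; first by rewrite tparent_root.
by rewrite vp => -[pv]; apply: IHp; rewrite {1}pv vp.
Qed.

Lemma climb_anti u v : v \in tverts T -> climb v u -> climb u v -> u = v.
Proof.
move=> Tv; move: v Tv u; apply: tree_ind => [u /climb_root // | v p vp IHp u].
case/climb_inv=> [-> // | [q]]; rewrite vp => -[<-] pu uv.
have up : u = p by apply: IHp => //; apply: connect_trans (climb_parent vp).
rewrite up in uv *; symmetry; apply: IHp => //; exact: climb_parent.
Qed.

(** Parent links form a partial function, so of two climbs from [x] one extends the other. *)
Lemma climb_total x u v : climb x u -> climb x v -> climb u v \/ climb v u.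
Proof.
case/connectP=> q; elim: q x => [|p q IHq] x /=.
  by move=> _ -> xv; left.
case/andP=> /eqP xp pq lq /climb_inv[<- | [p']].
  by right; apply/connectP; exists (p :: q); rewrite //= xp eqxx.
by rewrite xp => -[<-]; apply: IHq.
Qed.

Lemma ancestor_refl v : v \in tverts T -> ancestor T v v.
Proof. by rewrite /ancestor => ->; apply: connect0. Qed.

Lemma ancestor_trans v u w : ancestor T u v -> ancestor T v w -> ancestor T u w.
Proof.
by case/andP=> _ vu /andP[Tw wv]; rewrite /ancestor Tw (connect_trans wv).
Qed.

Lemma ancestor_anti u v : ancestor T u v -> ancestor T v u -> u = v.
Proof. by case/andP=> Tv vu /andP[_ uv]; apply: climb_anti. Qed.

Lemma ancestor_parent v p : tparent T v = Some p -> ancestor T p v.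
Proof.
by move=> vp; rewrite /ancestor climb_parent // (tparent_in vp).1.
Qed.

Lemma ancestor_of_root v : ancestor T v (troot T) -> v = troot T.
Proof. by case/andP=> _ /climb_root. Qed.

Lemma ancestor_inv u v : ancestor T u v ->
  v = u \/ exists2 p, tparent T v = Some p & ancestor T u p.
Proof.
case/andP=> _ /climb_inv[| [p vp pu]]; first by left.
by right; exists p; rewrite // /ancestor pu (tparent_in vp).2.
Qed.

Lemma child_climb_inj p u v :
  tparent T u = Some p -> tparent T v = Some p -> climb u v -> u = v.
Proof.
move=> up vp /climb_inv[// | [q]]; rewrite up => -[<-] pv.
have pv' : p = v.
  by apply: climb_anti => //; [case: (tparent_in vp) | apply: climb_parent].
by case: (@tparent_irrefl p); rewrite {1}pv'.
Qed.

Lemma child_ancestor_inj p u v x :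
  tparent T u = Some p -> tparent T v = Some p ->
  ancestor T u x -> ancestor T v x -> u = v.
Proof.
move=> up vp /andP[_ xu] /andP[_ xv].
case: (climb_total xu xv) => [uv | vu]; first exact: child_climb_inj up vp uv.
by symmetry; apply: child_climb_inj vp up vu.
Qed.

End RootedTree.

(** * Preorders induced by a numbering of siblings *)

Section Lexicographic.
Implicit Types k l x y : seqlexi nat.

Lemma lexi_catr k l : (k <= k ++ l :> seqlexi nat)%O.
Proof.
by elim: k => [|a k IHk]; rewrite ?lexi0s //= lexi_cons lexx IHk.
Qed.

Lemma lexi_cat2l k x y : (k ++ x <= k ++ y :> seqlexi nat)%O = (x <= y)%O.
Proof. by elim: k => [|a k IHk] //=; rewrite lexi_cons lexx IHk. Qed.

(** Sequences with prefix [k] form a lexicographic interval; this makes subtrees consecutive. *)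
Lemma lexi_between_cat k l1 l2 y :
  (k ++ l1 <= y :> seqlexi nat)%O -> (y <= k ++ l2 :> seqlexi nat)%O ->
  exists l, y = k ++ l.
Proof.
elim: k y => [|a k IHk] [|b y] //=; [by exists [::] | by exists (b :: y) |].
rewrite !lexi_cons => /andP[ab aby] /andP[ba bay].
have eab : a = b by apply/eqP; rewrite eq_le ab ba.
move: aby bay; rewrite eab lexx /= => ky yk.
by have [l ->] := IHk _ ky yk; exists l.
Qed.

End Lexicographic.

Section Keys.
Variables (V : finType) (T : rooted_tree V) (f : V -> nat).
Hypothesis f_inj : forall v w p,
  tparent T v = Some p -> tparent T w = Some p -> f v = f w -> v = w.

Fixpoint key_upto (d : nat) (v : V) : seqlexi nat :=
  if d is d'.+1 then
    if tparent T v is Some p then rcons (key_upto d' p) (f v) else [::]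
  else [::].

(* The values of [f] on the tree path from the root (excluded) down to [v];
   the number of ancestors of [v] suffices as fuel. *)
Definition key (v : V) : seqlexi nat :=
  key_upto #|[set u | ancestor T u v]| v.

Lemma key_root : key (troot T) = [::].
Proof. by rewrite /key; case: #|_| => //= n; rewrite tparent_root. Qed.

Lemma key_parent v p : tparent T v = Some p -> key v = rcons (key p) (f v).
Proof.
move=> vp; have [Tv Tp] := tparent_in vp.
suff -> : key v = key_upto #|[set u | ancestor T u p]|.+1 v by rewrite /= vp.
congr key_upto.
(* [v] has one ancestor more than its parent, matching the unit of fuel that one unfolding
   spends. *)
have -> : [set u | ancestor T u v] = v |: [set u | ancestor T u p].
  apply/setP=> u; rewrite !inE; apply/idP/orP.
    by case/ancestor_inv=> [-> | [q]]; [left | rewrite vp => -[<-]; right].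
  case=> [/eqP-> | up]; first exact: ancestor_refl.
  exact: ancestor_trans up (ancestor_parent vp).
rewrite cardsU1 inE; case: (boolP (ancestor T v p)) => //= pv.
have vp' := ancestor_anti pv (ancestor_parent vp).
by case: (@tparent_irrefl _ T v); rewrite {2}vp'.
Qed.

Lemma key_ancestor u v : ancestor T u v -> exists l, key v = key u ++ l.
Proof.
move=> uv; have Tv : v \in tverts T by case/andP: uv.
move: v Tv u uv; apply: tree_ind => [u /ancestor_of_root-> | v p vp IHp u].
  by exists [::]; rewrite cats0.
case/ancestor_inv=> [-> | [q]]; first by exists [::]; rewrite cats0.
rewrite vp => -[<-] /IHp[l kp]; exists (rcons l (f v)).
by rewrite (key_parent vp) kp rcons_cat.
Qed.

Lemma key_inj : {in tverts T &, injective key}.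
Proof.
move=> v w Tv Tw; move: v Tv w Tw.
apply: tree_ind => [w | v p vp IHp w] Tw.
  move: w Tw; apply: tree_ind => // w q wq _.
  by rewrite key_root (key_parent wq); case: (key q).
rewrite (key_parent vp); move: w Tw; apply: tree_ind => [ | w q wq _].
  by rewrite key_root; case: (key p).
rewrite (key_parent wq) => /rcons_inj[kpq fvw].
have pq : p = q by apply: IHp => //; case: (tparent_in wq).
by apply: f_inj fvw; [exact: vp | rewrite pq].
Qed.

(** Dropping the last entry climbs to the parent; once the suffix is empty, [key_inj] identifies the
    vertices. *)
Lemma key_cat_ancestor u v (l : seqlexi nat) :
  u \in tverts T -> v \in tverts T -> key v = key u ++ l -> ancestor T u v.
Proof.
move=> Tu Tv; move: v Tv u l Tu.
apply: tree_ind => [u l Tu | v p vp IHp u l Tu].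
  rewrite key_root => kul.
  have ku : key u = [::] by move: kul; case: (key u).
  rewrite (@key_inj u (troot T)) ?key_root ?troot_in //.
  exact/ancestor_refl/troot_in.
have [Tv Tp] := tparent_in vp.
case/lastP: l => [|l a].
  by rewrite cats0 => /key_inj<- //; apply: ancestor_refl.
rewrite (key_parent vp) -rcons_cat => /rcons_inj[/(IHp _ _ Tu) up _].
exact: ancestor_trans up (ancestor_parent vp).
Qed.

Definition key_le : rel V :=
  fun x y => [&& x \in tverts T, y \in tverts T & (key x <= key y)%O].

Lemma key_le_preorder : is_preorder T key_le.
Proof.
split.
  split; first by move=> x y /and3P[].
  split.
  - by move=> x Tx; rewrite /key_le Tx lexx.
  - move=> x y Tx Ty /andP[/and3P[_ _ xy] /and3P[_ _ yx]].
    by apply: key_inj => //; apply/eqP; rewrite eq_le xy yx.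
  - move=> y x z Ty Tx Tz /and3P[_ _ xy] /and3P[_ _ yz].
    by rewrite /key_le Tx Tz (le_trans xy yz).
  - by move=> x y Tx Ty; rewrite /key_le Tx Ty le_total.
move=> v Tv; split.
  move=> w vw; have [l kw] := key_ancestor vw.
  by case/andP: vw => Tw _; rewrite /key_le Tv Tw kw lexi_catr.
move=> x y z vx vz /and3P[_ Ty xy] /and3P[_ _ yz].
have [l1 kx] := key_ancestor vx; have [l2 kz] := key_ancestor vz.
rewrite kx in xy; rewrite kz in yz.
have [l ky] := lexi_between_cat xy yz.
exact: key_cat_ancestor ky.
Qed.

(** Both keys extend [key p], and the next entries, [f u'] and [f w'], decide the comparison. *)
Lemma key_le_subtrees p u' w' u w :
  tparent T u' = Some p -> tparent T w' = Some p -> f u' < f w' ->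
  ancestor T u' u -> ancestor T w' w -> strict key_le u w.
Proof.
move=> u'p w'p fuw u'u w'w.
have uw : u != w.
  apply: contraTneq fuw => uw; rewrite -{}uw in w'w.
  by rewrite (child_ancestor_inj u'p w'p u'u w'w) ltnn.
have [l1 ku] := key_ancestor u'u; have [l2 kw] := key_ancestor w'w.
case/andP: u'u => Tu _; case/andP: w'w => Tw _.
rewrite /strict uw /key_le Tu Tw ku kw (key_parent u'p) (key_parent w'p) /=.
rewrite !cat_rcons lexi_cat2l lexi_cons leEnat (ltnW fuw).
by rewrite [f w' <= _]leqNgt fuw.
Qed.

End Keys.

(** * Dominance *)

Section Dominance.
Variable G : flow_graph.
Implicit Types u v w x : G.
Local Notation s := (start G).

Definition avoid (v : G) : rel G := [rel a b | arc a b && (b != v)].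

(** [avoid v] bars only arcs into [v], so [v = s], which every walk contains from the outset, is a
    separate case. The boolean form makes dominance decidable. *)
Lemma dominatesP v w :
  reflect (dominates v w) ((v == s) || ~~ connect (avoid v) s w).
Proof.
have pathE p : v \notin p -> path (avoid v) s p = path (@arc G) s p.
  elim: p (s) => [|b p IHp] a //=; rewrite inE negb_or => /andP[vb vp].
  by rewrite IHp // /avoid /= eq_sym vb andbT.
apply: (iffP orP) => [[/eqP-> p _ _ | Nvw p sp pw] | dvw].
- exact: mem_head.
- apply: contraR Nvw; rewrite inE negb_or => /andP[_ vp].
  by apply/connectP; exists p; rewrite // pathE.
have [_ | vs] := eqVneq v s; [by left | right].
apply/negP => /connectP[p av_p pw].
have vp : v \notin p.
  apply/negP; elim: p (s) {pw vs pathE} av_p => [|b p IHp] a //=.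
  case/andP=> /andP[_ bv] bp; rewrite inE eq_sym (negbTE bv) /=.
  exact: IHp bp.
have := dvw p; rewrite -pathE // inE (negbTE vs) (negbTE vp) /=.
by move/(_ av_p (esym pw)).
Qed.

Lemma dominates_pred v u w : dominates v w -> arc u w -> w <> v -> dominates v u.
Proof.
move=> dvw uw wv p sp pu.
have := dvw (rcons p w); rewrite rcons_path sp pu last_rcons uw => /(_ _ _).
move=> /(_ isT erefl); rewrite !inE mem_rcons inE.
by case/or3P=> [-> | /eqP vw | ->]; rewrite ?orbT //; case: wv.
Qed.

(** A simple path to [v] passes through [w], and its part up to [w] already contains [v], so it ends
    at [w]. *)
Lemma dominates_anti v w : dominates v w -> dominates w v -> v = w.
Proof.
move=> dvw dwv; have /connectP[p0 sp0 p0v] := start_reach v.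
move: p0v; case/shortenP: sp0 => p sp Up _ pv.
have wp := dwv p sp (esym pv).
case/splitPl: wp sp Up pv => p1 p2 p1w; rewrite cat_path => /andP[sp1 _] Up pv.
have vp1 := dvw p1 sp1 p1w.
case: p2 Up pv => [_ | b p2]; first by rewrite cats0 p1w.
rewrite -cat_cons cat_uniq last_cat => /and3P[_ /hasPn N _] /= pv.
have /N := mem_last b p2.
by rewrite -pv vp1.
Qed.

Lemma dominates_start v : dominates v s -> v = s.
Proof. by move/(_ [::] isT erefl); rewrite inE => /eqP. Qed.

Lemma in_arc v : v <> s -> exists u, arc u v.
Proof.
move=> vs; have : v = s \/ exists u, arc u v; last by case.
apply: (connect_invariant (P := fun v => v = s \/ exists u, arc u v))
  (start_reach v) => [|a b _ _ ab]; first by left.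
by right; exists a.
Qed.

(** Such an arc lets the parent property place [s] in the tree. *)
Lemma start_out_arc : exists w, arc s w.
Proof.
have /card_gt1P[x [y [_ _ xy]]] := vertex_gt1 G.
have [v vs] : exists v, v <> s.
  have [xs | /eqP xs] := eqVneq x s; last by exists x.
  by exists y => ys; rewrite xs ys eqxx in xy.
have /connectP[[|w p] /=] := start_reach v; first by [].
by case/andP=> sw _ _; exists w.
Qed.

End Dominance.

(** * Dominance and low-high orders for trees with the parent property *)

Section ParentProperty.
Variables (G : flow_graph) (T : rooted_tree G).
Hypothesis hT : parent_property T.
Implicit Types p u v w x y : G.
Local Notation s := (start G).

Lemma has_parent v : v <> s -> exists p, tparent T v = Some p.
Proof. by case/in_arc=> u /hT[p vp _]; exists p. Qed.

Lemma in_tree v : v \in tverts T.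
Proof.
have [-> | /eqP/has_parent[p /tparent_in[]//]] := eqVneq v s.
by have [w /hT[p _ /andP[]]] := start_out_arc G.
Qed.

Lemma troot_start : troot T = s.
Proof.
have [// | /eqP/has_parent[p]] := eqVneq (troot T) s.
by rewrite tparent_root.
Qed.

(** The tail of an arc is a descendant of the parent of its head, so a walk from [s] can enter the
    subtree of [v] only at [v]. *)
Lemma ancestor_dominates v w : ancestor T v w -> dominates v w.
Proof.
move=> vw; apply/dominatesP; have [// | vs] := eqVneq v s; apply/negP => /=.
move=> sw; move: vw; apply/negP.
apply: (connect_invariant (P := fun w => ~~ ancestor T v w)) sw.
  apply: contra vs; rewrite -troot_start => /ancestor_of_root->.
  by rewrite troot_start.
move=> a b _ Na /andP[/hT[p bp pa] bv]; apply: contra Na.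
case/ancestor_inv=> [bv' | [q]]; first by rewrite bv' eqxx in bv.
by rewrite bp => -[<-] vp; apply: ancestor_trans vp pa.
Qed.

(* Otherwise let [C] be the set of vertices dominated by [v] but outside its
   subtree.  Every predecessor of a vertex of [C] is dominated by [v].  If [C]
   meets the part of the order below [v], the low arc of its minimum contradicts
   minimality; if it meets the part above [v], so does, for maximality, the high
   arc of the topmost ancestor in [C] of its maximum. *)
Lemma low_high_dominates_ancestor (le : rel G) v w :
  is_preorder T le -> low_high T le -> dominates v w -> ancestor T v w.
Proof.
case=> [[_ [le_refl' le_anti' le_trans' le_total']] le_pre] le_lh dvw.
have le_refl : reflexive le by move=> x; apply: le_refl'; exact: in_tree.
have le_anti x y : le x y -> le y x -> x = y.
  by move=> xy yx; apply: le_anti'; rewrite ?in_tree // xy yx.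
have le_trans : transitive le.
  by move=> y x z; apply: le_trans'; exact: in_tree.
have le_total : total le by move=> x y; apply: le_total'; exact: in_tree.
have le_desc x y : ancestor T x y -> le x y.
  by have [+ _] := le_pre x (in_tree x); apply.
have le_conv x a b c : ancestor T x a -> ancestor T x c ->
    le a b -> le b c -> ancestor T x b.
  by have [_ +] := le_pre x (in_tree x); apply.
have ge_refl : reflexive (fun x y => le y x) by exact: le_refl.
have ge_trans : transitive (fun x y => le y x).
  by move=> y x z yx zy; apply: le_trans zy yx.
have ge_total : total (fun x y => le y x) by move=> x y; apply: le_total.
apply/negPn/negP => Nvw.
pose C x := ((v == s) || ~~ connect (avoid v) s x) && ~~ ancestor T v x.
have CP x : dominates v x -> ~~ ancestor T v x -> C x.
  by move=> /dominatesP dvx Nvx; rewrite /C dvx.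
have Cdom x : C x -> dominates v x by case/andP=> /dominatesP.
have CN x : C x -> ~~ ancestor T v x by case/andP.
have Cv x : C x -> x <> v.
  by move=> /CN Nvx xv; rewrite xv ancestor_refl ?in_tree in Nvx.
have Cs x : C x -> x <> s.
  move=> Cx xs; have := CN _ Cx; rewrite xs in Cx *.
  rewrite (dominates_start (Cdom _ Cx)) -troot_start.
  by rewrite ancestor_refl ?in_tree.
have Cpred x u : C x -> arc u x -> dominates v u.
  by move=> Cx ux; apply: dominates_pred (Cdom _ Cx) ux (Cv _ Cx).
have Cparent x p : C x -> tparent T x = Some p -> arc p x -> C p.
  move=> Cx xp px; apply: CP; first exact: Cpred px.
  apply: contra (CN _ Cx) => vp.
  exact: ancestor_trans vp (ancestor_parent xp).
have parent_lt x p : tparent T x = Some p -> ~ le x p.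
  move=> xp le_xp; apply: (@tparent_irrefl _ T x); rewrite xp.
  by rewrite (le_anti x p) // le_desc // ancestor_parent.
have Cw : C w by apply: CP.
have [le_wv | le_vw] := orP (le_total w v).
  have [x Cx minx] := @extremumP _ _ le w C id le_refl le_trans le_total Cw.
  have xv : le x v := le_trans _ _ _ (minx _ Cw) le_wv.
  case: (le_lh x (Cs _ Cx)) => [[p xp px] | [u [_ [ux _ /andP[u_x le_ux] _ _]]]].
    exact: parent_lt xp (minx _ (Cparent _ _ Cx xp px)).
  suff Cu : C u by case/eqP: u_x; apply: le_anti => //; apply: minx.
  apply: CP; first exact: Cpred ux.
  (* If [u] were a descendant of [v], so would be [x], which lies between [u] and [v] in the
     order. *)
  apply: contra (CN _ Cx) => vu.
  by apply: le_conv vu (ancestor_refl (in_tree v)) le_ux xv.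
have [x1 Cx1 maxx1] :=
  @extremumP _ _ (fun x y => le y x) w C id ge_refl ge_trans ge_total Cw.
have vx1 : le v x1 := le_trans _ _ _ le_vw (maxx1 _ Cw).
have Cx1' : C x1 && ancestor T x1 x1 by rewrite Cx1 ancestor_refl ?in_tree.
(* Ancestors precede descendants, so the least ancestor of [x1] in [C] is the topmost one. *)
have [x /andP[Cx xx1] minx] :=
  @extremumP _ _ le x1 (fun y => C y && ancestor T y x1) id
    le_refl le_trans le_total Cx1'.
(* Otherwise [v] lies between [x] and [x1], hence below [x] in the tree, and [x] and [v] dominate
   each other. *)
have vx : le v x.
  have [xv | //] := orP (le_total x v).
  have axv := le_conv _ _ _ _ (ancestor_refl (in_tree x)) xx1 xv vx1.
  case: (Cv _ Cx); apply: dominates_anti (Cdom _ Cx).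
  exact: ancestor_dominates.
case: (le_lh x (Cs _ Cx)) => [[p xp px] | ].
  apply: (parent_lt _ _ xp); apply: minx; rewrite (Cparent _ _ Cx xp px) /=.
  exact: ancestor_trans (ancestor_parent xp) xx1.
case=> [_ [z [_ zx _ /andP[x_z le_xz] /negP]]]; apply.
(* With [z] in [C], maximality of [x1] puts [z] between [x] and [x1], hence in the subtree of [x],
   which the high arc excludes. *)
suff Cz : C z.
  exact: le_conv (ancestor_refl (in_tree x)) xx1 le_xz (maxx1 _ Cz).
apply: CP; first exact: Cpred zx.
apply: contra (CN _ Cx) => vz.
exact: le_conv (ancestor_refl (in_tree v)) vz vx le_xz.
Qed.

Lemma low_high_sibling (le : rel G) :
  is_preorder T le -> low_high T le -> sibling_property T.
Proof.
move=> pre lh v w [vw [p [vp wp]]] /(low_high_dominates_ancestor pre lh) avw.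
exact/vw/(child_ancestor_inj vp wp avw)/ancestor_refl/in_tree.
Qed.

(* Contracts the subtree of each child of [p]. *)
Definition derived_arc (p : G) : rel G :=
  fun a b => if a == p then arc p b else [exists x, ancestor T a x && arc x b].

Definition children (p : G) : {set G} := [set v | tparent T v == Some p].

(** This projects a walk to the contracted graph: by the parent property it enters the subtree of
    [p] at [p], and the subtree of a child at that child, where [Q] holds. *)
Lemma reach_derived p (Q : pred G) x :
  connect [rel a b | arc a b && Q b] s x -> ancestor T p x ->
  x = p \/ exists2 c, tparent T c = Some p & ancestor T c x /\
             reach_in (derived_arc p) p [set y in children p | Q y] c.
Proof.
apply: (connect_invariant (P := fun x => ancestor T p x -> x = p \/
  exists2 c, tparent T c = Some p & ancestor T c x /\
    reach_in (derived_arc p) p [set y in children p | Q y] c)).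
  by rewrite -troot_start => /ancestor_of_root->; left.
move=> x0 z _ IH /andP[xz Qz] /ancestor_inv[-> | [q zq pq]]; first by left.
have [q' + qx] := hT xz; rewrite zq => -[eq_qq']; subst q'.
have Tz := in_tree z.
have IHx := IH (ancestor_trans pq qx).
(* If the parent of [z] is not [p], the walk stays below the same child [c]; otherwise it enters the
   child [z] itself by a derived arc. *)
right; have [eq_qp | q_p] := eqVneq q p; last first.
  case: IHx => [xp | [c cp [cx Rc]]].
    by case/eqP: q_p; apply: ancestor_anti pq; rewrite -xp.
  exists c => //; split=> //.
  have : ancestor T c q.
    case/andP: cx => _ xc; case/andP: qx => _ xq.
    case: (climb_total xc xq) => [cq | qc]; last by rewrite /ancestor in_tree.
    have : ancestor T q c by rewrite /ancestor in_tree.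
    case/ancestor_inv=> [-> | [p']]; first exact: ancestor_refl (in_tree _).
    rewrite cp => -[<-] qp.
    by case/eqP: q_p; apply: ancestor_anti qp pq.
  by move=> cq; apply: ancestor_trans cq (ancestor_parent zq).
rewrite eq_qp in zq; exists z => //; split; first exact: ancestor_refl.
have Xz : z \in [set y in children p | Q y] by rewrite !inE zq eqxx.
case: IHx => [xp | [c cp [cx Rc]]].
  apply: reach_in_step (connect0 _ _) _ Xz.
  by rewrite /derived_arc eqxx -xp.
apply: reach_in_step Rc _ Xz; rewrite /derived_arc ifN.
  by apply/existsP; exists x0; rewrite cx.
by apply/eqP => c_p; apply: (@tparent_irrefl _ T p); rewrite -{1}c_p.
Qed.

Lemma sibling_low_high : sibling_property T ->
  exists le : rel G, is_preorder T le /\ low_high T le.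
Proof.
move=> sib.
have numbering p : exists f : G -> nat, {in children p &, injective f} /\
    {in children p, forall y, derived_arc p p y \/
      (exists2 u, u \in children p & derived_arc p u y /\ f u < f y) /\
      (exists2 w, w \in children p & derived_arc p w y /\ f y < f w)}.
  (* [Q] is used twice: as [predT] for plain reachability, and as [!= v] for reachability avoiding a
     sibling [v]. *)
  have reach Q y : y \in children p ->
      connect [rel a b | arc a b && Q b] s y ->
      reach_in (derived_arc p) p [set y in children p | Q y] y.
    rewrite inE => /eqP yp sy.
    case: (reach_derived sy (ancestor_parent yp)) => [y_p | [c cp [cy]]].
      by case: (@tparent_irrefl _ T p); rewrite -{1}y_p.
    by rewrite (child_ancestor_inj cp yp cy (ancestor_refl (in_tree y))).
  have [] // := @low_high_numbering G (derived_arc p) p (children p).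
  - by rewrite inE; apply/eqP/tparent_irrefl.
  - move=> y Ky; have -> : children p = [set y in children p | predT y].
      by apply/setP=> z; rewrite !inE andbT.
    apply: reach => //; apply: connect_sub (start_reach y) => a b ab.
    by apply: connect1; rewrite /= ab.
  - move=> v y Kv Ky vy.
    have -> : children p :\ v = [set y in children p | y != v].
      by apply/setP=> z; rewrite !inE andbC.
    apply: (reach (fun z => z != v)) => //.
    apply/negPn/negP => Ny; apply: (sib v y).
      split; first exact/eqP.
      by move: Kv Ky; rewrite !inE => /eqP vp /eqP yp; exists p.
    by apply/dominatesP/orP; right.
  - by move=> f injf lhf; exists f.
have [F FP] := fin_all_exists numbering.
(* Each vertex is numbered among its siblings. The default [v] concerns only a vertex without a
   parent, where [key] does not read [f]. *)
pose f v := F (odflt v (tparent T v)) v.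
have fE v p : tparent T v = Some p -> f v = F p v by rewrite /f => ->.
have f_inj v w p :
    tparent T v = Some p -> tparent T w = Some p -> f v = f w -> v = w.
  move=> vp wp; rewrite (fE _ _ vp) (fE _ _ wp) => Fvw.
  by have [injF _] := FP p; apply: injF; rewrite // inE ?vp ?wp.
exists (key_le T f); split; first exact: key_le_preorder.
move=> v /has_parent[p vp]; have [_ lhF] := FP p.
have Kv : v \in children p by rewrite inE vp.
have derivedP c : c \in children p -> derived_arc p c v ->
    exists2 x, ancestor T c x & arc x v.
  rewrite inE /derived_arc => /eqP cp; rewrite ifN.
    by case/existsP=> x /andP[]; exists x.
  by apply/eqP => c_p; apply: (@tparent_irrefl _ T p); rewrite -{1}c_p.
case: (lhF v Kv) => [pv | ].
  by left; exists p; rewrite // /derived_arc eqxx in pv *.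
case=> -[u' Ku' [/(derivedP _ Ku')[u u'u uv] fu]].
case=> w' Kw' [/(derivedP _ Kw')[w w'w wv] fw].
move: Ku' Kw'; rewrite !inE => /eqP u'p /eqP w'p; right; exists u, w.
have vv := ancestor_refl (in_tree v).
split=> //.
- by apply: (key_le_subtrees u'p vp _ u'u vv); rewrite (fE _ _ u'p) (fE _ _ vp).
- by apply: (key_le_subtrees vp w'p _ vv w'w); rewrite (fE _ _ w'p) (fE _ _ vp).
apply: contraTN fw => vw.
by rewrite (child_ancestor_inj vp w'p vw w'w) ltnn.
Qed.

End ParentProperty.

Theorem theorem27 (G : flow_graph) (T : rooted_tree G)
    (hT : parent_property T) :
  (sibling_property T <->
     exists le : rel G, is_preorder T le /\ low_high T le) /\
  (sibling_property T -> is_dominator_tree T).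
Proof.
split.
  split; first exact: sibling_low_high.
  by case=> le [pre lh]; apply: low_high_sibling pre lh.
move=> /(sibling_low_high hT)[le [pre lh]]; split.
- exact: troot_start.
- by apply/setP=> v; rewrite inE; apply: in_tree.
- move=> v w; split; first exact: ancestor_dominates.
  exact: low_high_dominates_ancestor pre lh.
Qed.
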